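(* For $n\ge 2$, the polynomials $P_n(x)$, $P_n^+(x)$, $P_n^-(x)$ all belong to ${\rm RZ}(-\infty,0)$, and $$P_{n+1}(x)\ll S_n(x),\qquad P^+_{n+1}(x)\prec S_n(x),\qquad S_n(x)\ll P^-_{n+1}(x).$$
   Context: For a permutation $\pi$ of $[n]=\{1,\dots,n\}$, ${\rm des}(\pi)=\#\{i\in[n-1]:\pi(i)>\pi(i+1)\}$. A double descent is an index $i\in[n-2]$ with $\pi(i)>\pi(i+1)>\pi(i+2)$; $\pi$ is simsun if for every $k\in[n]$ the subword of $\pi$ consisting of the letters in $[k]$ (in order of appearance) has no double descents. Let $\mathcal{RS}_n$ be the set of simsun permutations of $[n]$, $\mathcal{RS}_n^+=\{\pi\in\mathcal{RS}_n:\pi(1)>\pi(2)\}$, $\mathcal{RS}_n^-=\{\pi\in\mathcal{RS}_n:\pi(1)<\pi(2)\}$, and $S_n(x)=\sum_{\pi\in\mathcal{RS}_n}x^{{\rm des}(\pi)}$. An interior peak of $\pi$ is an index $i\in\{2,\dots,n-1\}$ with $\pi(i-1)<\pi(i)>\pi(i+1)$; ${\rm pk}(\pi)$ is their number. Let $P_n(x)=\sum_{\pi\in\mathcal{RS}_n}x^{{\rm pk}(\pi)}$, $P^\pm_n(x)=\sum_{\pi\in\mathcal{RS}^\pm_n}x^{{\rm pk}(\pi)}$. ${\rm RZ}(I)$ denotes the set of real polynomials all of whose zeros are real and lie in the interval $I$. For real-rooted $p,q$ with zeros $\xi_1\le\dots\le\xi_n$ of $p$ and $\theta_1\le\dots\le\theta_m$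 of $q$: $p$ interlaces $q$ (written $p\dagger q$) if $\deg q=1+\deg p$ and $\theta_1\le\xi_1\le\theta_2\le\cdots\le\xi_n\le\theta_{n+1}$; $p$ alternates left of $q$ (written $p\ll q$) if $\deg p=\deg q$ and $\xi_1\le\theta_1\le\xi_2\le\cdots\le\xi_n\le\theta_n$; $p\prec q$ means $p\dagger q$ or $p\ll q$. By convention $a\prec bx+c$ for any real constants $a,b,c$. *)

(* Defs.v *)
From HB Require Import structures.
From mathcomp Require Import all_boot all_order all_algebra.
From mathcomp Require Import reals.
Set Implicit Arguments. Unset Strict Implicit. Unset Printing Implicit Defensive.
Import Order.TTheory GRing.Theory Num.Theory.

(* Permutations of [n] = {1,...,n} represented as sequences (one-line notation). *)

Definition des (s : seq nat) : nat :=
  \sum_(i < (size s).-1) (nth 0 s i.+1 < nth 0 s i)%N.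

(* interior peaks: 1-indexed i in {2..n-1}, i.e. 0-indexed i in {1..n-2} *)
Definition pk (s : seq nat) : nat :=
  \sum_(1 <= i < (size s).-1) ((nth 0 s i.-1 < nth 0 s i) && (nth 0 s i.+1 < nth 0 s i))%N.

Definition has_ddes (s : seq nat) : bool :=
  [exists i : 'I_(size s).-2,
     (nth 0 s i.+1 < nth 0 s i) && (nth 0 s i.+2 < nth 0 s i.+1)]%N.

Definition simsun (n : nat) (s : seq nat) : bool :=
  [forall k : 'I_n, ~~ has_ddes [seq x <- s | (x <= k.+1)%N]].

Definition perms (n : nat) : seq (seq nat) := permutations (iota 1 n).

Definition RS (n : nat) : seq (seq nat) := [seq s <- perms n | simsun n s].
Definition RSplus (n : nat) : seq (seq nat) :=
  [seq s <- RS n | (nth 0 s 1 < nth 0 s 0)%N].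
Definition RSminus (n : nat) : seq (seq nat) :=
  [seq s <- RS n | (nth 0 s 0 < nth 0 s 1)%N].

Local Open Scope ring_scope.

Definition Spoly (R : realType) (n : nat) : {poly R} := \sum_(s <- RS n) 'X^(des s).
Definition Ppoly (R : realType) (n : nat) : {poly R} := \sum_(s <- RS n) 'X^(pk s).
Definition Pplus (R : realType) (n : nat) : {poly R} := \sum_(s <- RSplus n) 'X^(pk s).
Definition Pminus (R : realType) (n : nat) : {poly R} := \sum_(s <- RSminus n) 'X^(pk s).

(* xs is the nondecreasing list of the zeros of p (with multiplicity), and all
   zeros of p are real: p splits into real linear factors. *)
Definition zeros_of (R : realType) (p : {poly R}) (xs : seq R) : Prop :=
  p != 0 /\ sorted <=%R xs /\ p = lead_coef p *: \prod_(x <- xs) ('X - x%:P).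

Definition real_rooted (R : realType) (p : {poly R}) : Prop := exists xs, zeros_of p xs.

Definition RZneg (R : realType) (p : {poly R}) : Prop :=
  exists xs, zeros_of p xs /\ all (fun x => x < 0) xs.

Definition interlaces (R : realType) (p q : {poly R}) : Prop :=
  exists xs ts, zeros_of p xs /\ zeros_of q ts /\
    (size q = (size p).+1)%N /\
    forall i, (i < size xs)%N -> ts`_i <= xs`_i /\ xs`_i <= ts`_i.+1.

Definition alt_left (R : realType) (p q : {poly R}) : Prop :=
  exists xs ts, zeros_of p xs /\ zeros_of q ts /\
    size q = size p /\
    (forall i, (i < size xs)%N -> xs`_i <= ts`_i) /\
    (forall i, (i.+1 < size xs)%N -> ts`_i <= xs`_i.+1).

(* p prec q, with the convention a prec bx+c for real constants a, b, c *)
Definition prec (R : realType) (p q : {poly R}) : Prop :=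
  interlaces p q \/ alt_left p q \/ ((size p <= 1)%N /\ (size q <= 2)%N).

(* Main.v *)
(* Inserting the letter n+1 into a simsun permutation of [n] with k descents
   keeps des in k+1 ways and raises it in n-2k ways, whence
   S_{n+1} = (1 + n x) S_n + x (1 - 2x) S_n'. Without double descents, pk and des
   differ only by an initial descent, so S_n = P^-_n + x P^+_n; tracking the first
   step through the insertion gives
     P^-_{n+1} = S_n + x S_n',  P^+_{n+1} = n S_n - 2x S_n',
     P_{n+1} = (n+1) S_n - x S_n'.
   By the recurrence S_n has simple negative zeros, and at these zeros all the
   polynomials above have the sign of +-S_n'. These signs alternate, so the
   intermediate value theorem, with the signs at -oo and 0, locates every zero. *)
Require Import Defs.
From mathcomp Require Import all_boot all_order all_algebra reals polyrcf.
From mathcomp Require Import ring lra zify.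
Set Implicit Arguments. Unset Strict Implicit. Unset Printing Implicit Defensive.
Import Order.TTheory GRing.Theory Num.Theory.

(** * Insertion of the largest letter *)

Lemma des_cons2 a b s : des [:: a, b & s] = ((b < a) + des (b :: s))%N.
Proof. by rewrite /des /= big_ord_recl. Qed.

(** With default [b] in [head], the second comparison is false for empty [s], so the two-letter word
    obeys the same formula. *)
Lemma has_ddes_cons2 a b s :
  has_ddes [:: a, b & s] = ((b < a) && (head b s < b) || has_ddes (b :: s))%N.
Proof.
case: s => [|c s] /=.
  by rewrite ltnn andbF /=; apply/existsP/existsP => -[[]].
apply/existsP/orP => [[[[|i] ilt] /= h]|[h|/existsP[[i ilt] h]]].
- by left.
- by right; apply/existsP; exists (Ordinal (ilt : (i < (size [:: b, c & s]).-2)%N)).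
- by exists ord0.
- by exists (Ordinal (ilt : (i.+1 < (size [:: a, b, c & s]).-2)%N)).
Qed.

Lemma has_ddes1 a : has_ddes [:: a] = false.
Proof. by apply/existsP => -[[]]. Qed.

Lemma has_ddes0 : has_ddes [::] = false.
Proof. by apply/existsP => -[[]]. Qed.

Lemma des1 a : des [:: a] = 0%N.
Proof. by rewrite /des big_ord0. Qed.

Lemma des0 : des [::] = 0%N.
Proof. by rewrite /des big_ord0. Qed.

Definition ins (m j : nat) (s : seq nat) := take j s ++ m :: drop j s.

Lemma perm_ins m j s : perm_eq (ins m j s) (m :: s).
Proof. by rewrite /ins perm_catC /= perm_cons perm_catC cat_take_drop. Qed.

Lemma filter_ins (p : pred nat) m j s :
  ~~ p m -> filter p (ins m j s) = filter p s.
Proof.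
by move=> /negbTE pm; rewrite /ins filter_cat /= pm -filter_cat cat_take_drop.
Qed.

Lemma index_ins m j s : m \notin s -> (j <= size s)%N -> index m (ins m j s) = j.
Proof.
move=> ms js; rewrite /ins index_cat.
have /negbTE -> : m \notin take j s by apply: contra ms => /mem_take.
by rewrite /= eqxx addn0 size_takel.
Qed.

Lemma ins_index_rem m t : m \in t -> ins m (index m t) (rem m t) = t.
Proof.
move=> mt; rewrite remE /ins.
have it : size (take (index m t) t) = index m t by rewrite size_takel // index_size.
rewrite take_cat it ltnn subnn take0 cats0 drop_cat it ltnn subnn drop0.
have -> : m :: drop (index m t).+1 t = drop (index m t) t.
  by rewrite [RHS](drop_nth 0%N) ?index_mem // nth_index.
by rewrite cat_take_drop.
Qed.

Lemma simsun_ddes n s : perm_eq s (iota 1 n) -> simsun n s -> ~~ has_ddes s.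
Proof.
case: n => [|n] sP sS.
  by rewrite (perm_nilP sP) has_ddes0.
move/forallP/(_ ord_max): sS; rewrite /= (_ : filter _ _ = s) //.
by apply/all_filterP/allP => x; rewrite (perm_mem sP) mem_iota add1n ltnS => /andP[].
Qed.

Lemma mem_RS n s : (s \in RS n) = perm_eq s (iota 1 n) && simsun n s.
Proof. by rewrite mem_filter mem_permutations andbC. Qed.

(** The subwords on the letters up to [k <= n] do not see the letter [n.+1]; the only further
    condition, [k = n.+1], concerns the whole word. *)
Lemma simsunS n t : perm_eq t (iota 1 n.+1) ->
  simsun n.+1 t = simsun n (rem n.+1 t) && ~~ has_ddes t.
Proof.
move=> tP.
have tU : uniq t by rewrite (perm_uniq tP) iota_uniq.
have full : [seq x <- t | (x <= n.+1)%N] = t.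
  by apply/all_filterP/allP => x; rewrite (perm_mem tP) mem_iota add1n ltnS => /andP[].
have filt k : (k <= n)%N ->
    [seq x <- rem n.+1 t | (x <= k)%N] = [seq x <- t | (x <= k)%N].
  move=> kn; rewrite rem_filter // -filter_predI; apply: eq_filter => x /=.
  by case: (leqP x k) => //= xk; rewrite neq_ltn (leq_ltn_trans xk).
apply/forallP/andP => [h|[/forallP h dt] k].
  split; last by move: (h ord_max); rewrite full.
  apply/forallP => k; rewrite filt //.
  by move: (h (widen_ord (leqnSn n) k)).
have [kn|kn] := ltnP k n.
  by have := h (Ordinal kn); rewrite /= filt.
have -> : val k = n by apply/eqP; rewrite eqn_leq kn -ltnS ltn_ord.
by rewrite full.
Qed.

Lemma RS_uniq n s : s \in RS n -> uniq s.
Proof. by rewrite mem_RS => /andP[/perm_uniq -> _]; rewrite iota_uniq. Qed.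

Lemma RS_size n s : s \in RS n -> size s = n.
Proof. by rewrite mem_RS => /andP[/perm_size -> _]; rewrite size_iota. Qed.

Lemma RS_ddes n s : s \in RS n -> ~~ has_ddes s.
Proof. by rewrite mem_RS => /andP[sP]; apply: simsun_ddes. Qed.

Lemma RS_lt n s : s \in RS n -> all (ltn^~ n.+1) s.
Proof.
rewrite mem_RS => /andP[sP _]; apply/allP => x.
by rewrite (perm_mem sP) mem_iota add1n => /andP[].
Qed.

Lemma RS_notin n s : s \in RS n -> n.+1 \notin s.
Proof. by move=> /RS_lt/allP h; apply/negP => /h /=; rewrite ltnn. Qed.

(** Both lists are duplicate-free, so equality of members suffices. Deleting [n.+1] and recording
    its index inverts the insertion. *)
Lemma perm_RSS n : perm_eq (RS n.+1)
  [seq t <- [seq ins n.+1 j s | s <- RS n, j <- iota 0 n.+1] | ~~ has_ddes t].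
Proof.
have iotaE : perm_eq (iota 1 n.+1) (n.+1 :: iota 1 n).
  have -> : iota 1 n.+1 = rcons (iota 1 n) n.+1.
    by rewrite -[n.+1 in LHS]addn1 iotaD add1n cats1.
  by rewrite perm_rcons.
apply: uniq_perm.
- by rewrite filter_uniq // permutations_uniq.
- rewrite filter_uniq // allpairs_uniq ?iota_uniq //.
    by rewrite filter_uniq // permutations_uniq.
  move=> [s i] [s' j] /allpairsPdep[u [k [uR kR [-> ->]]]].
  move=> /allpairsPdep[u' [k' [u'R k'R [-> ->]]]] /= e.
  rewrite !mem_iota /= !add0n !ltnS in kR k'R.
  (* Injectivity: filtering out [n.+1] recovers the word, and the index of [n.+1] then recovers the
     slot. *)
  have := congr1 (filter (predC1 n.+1)) e.
  rewrite !filter_ins /= ?eqxx //.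
  rewrite !(all_filterP _) => [uu||].
  + have := congr1 (index n.+1) e.
    by rewrite !index_ins ?(RS_notin uR) ?(RS_notin u'R) ?(RS_size uR) ?(RS_size u'R) // uu => ->.
  + by apply/allP => x /=; apply: contraTneq => ->; exact: RS_notin.
  + by apply/allP => x /=; apply: contraTneq => ->; exact: RS_notin.
- move=> t; rewrite mem_RS mem_filter; apply/andP/andP => [[tP tS]|[dt]].
    move: (tS); rewrite simsunS // => /andP[rS dt]; split=> //.
    have nt : n.+1 \in t by rewrite (perm_mem tP) mem_iota /= add1n ltnS leqnn.
    apply/allpairsPdep; exists (rem n.+1 t), (index n.+1 t); split.
    + rewrite (mem_RS n) rS andbT -(perm_cons n.+1).
      by apply: perm_trans (perm_trans tP iotaE); rewrite perm_sym perm_to_rem.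
    + rewrite mem_iota /= add0n; have: (index n.+1 t < size t)%N by rewrite index_mem.
      by rewrite [in X in (_ < X)%N](perm_size tP) size_iota.
    + by rewrite ins_index_rem.
  move=> /allpairsPdep[s [j [sR _ te]]].
  have sP : perm_eq s (iota 1 n) by move: sR; rewrite mem_RS => /andP[].
  have tP : perm_eq t (iota 1 n.+1).
    rewrite te (perm_trans (perm_ins _ _ _)) // perm_sym (perm_trans iotaE) //.
    by rewrite perm_cons perm_sym.
  split=> //; rewrite simsunS // dt andbT.
  suff -> : rem n.+1 t = s by move: sR; rewrite mem_RS => /andP[].
  rewrite rem_filter; last by rewrite (perm_uniq tP) iota_uniq.
  rewrite te filter_ins /= ?eqxx //; apply/all_filterP/allP => x /=.
  by apply: contraTneq => ->; exact: RS_notin.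
Qed.

Local Open Scope ring_scope.

(** * Descent generating function over the insertion slots of one word *)

Section Insertion.
Variable R : comNzRingType.
Implicit Types (s : seq nat) (m : nat).

Lemma sum_RSS (V : nmodType) n (Q : pred (seq nat)) (F : seq nat -> V) :
  \sum_(t <- RS n.+1 | Q t) F t =
  \sum_(s <- RS n) \sum_(j < n.+1 | ~~ has_ddes (ins n.+1 j s) && Q (ins n.+1 j s))
     F (ins n.+1 j s).
Proof.
rewrite (perm_big _ (perm_RSS n)) big_filter_cond big_mkcond big_allpairs_dep /=.
apply: eq_bigr => s _; rewrite [RHS]big_mkcond.
pose G j := if ~~ has_ddes (ins n.+1 j s) && Q (ins n.+1 j s) then F (ins n.+1 j s) else 0.
by rewrite -(big_mkord xpredT G) /index_iota subn0.
Qed.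

Definition ins_sum m (Q : pred (seq nat)) s : {poly R} :=
  \sum_(j < (size s).+1 | ~~ has_ddes (ins m j s) && Q (ins m j s)) 'X^(des (ins m j s)).

(** Only the slots behind the first letter [a]. The slot in front of a nonempty word always adds a
    descent, unlike a later slot, and so is handled apart from the induction. *)
Definition tail_sum m a s : {poly R} :=
  \sum_(j < (size s).+1 | ~~ has_ddes (a :: ins m j s)) 'X^(des (a :: ins m j s)).

Lemma ins0 m s : ins m 0 s = m :: s.
Proof. by rewrite /ins take0 drop0. Qed.

Lemma insS m j a s : ins m j.+1 (a :: s) = a :: ins m j s.
Proof. by []. Qed.

(* The slots creating a new descent are the ascents whose upper letter does not start
   a descent; the last term reflects that an initial descent blocks only the slot in
   front of [a], which is not counted here ([head a s < a] is false for empty [s]). *)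
Lemma tail_sumE m a s : ~~ has_ddes (a :: s) -> all (ltn^~ m) (a :: s) ->
  tail_sum m a s = (des (a :: s)).+1%:R *: 'X^(des (a :: s)) +
   ((size s)%:R - (des (a :: s)).*2%:R + (head a s < a)%N%:R) *: 'X^((des (a :: s)).+1).
Proof.
rewrite /tail_sum; elim: s a => [|b s IH] a.
  move=> _ /= /andP[am _]; rewrite big_mkcond big_ord1 ins0 has_ddes_cons2 /= has_ddes1.
  rewrite ltnn andbF /= des_cons2 !des1 ltnNge (ltnW am) /=.
  by rewrite ltnn !mulr0n subr0 addr0 scale0r addr0 scale1r.
rewrite has_ddes_cons2 negb_or => /andP[ab bs] /= /and3P[am bm sm].
have := IH b bs; rewrite /= bm sm => /(_ isT) {}IH.
rewrite big_mkcond big_ord_recl /= ins0 has_ddes_cons2 has_ddes_cons2 /=.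
rewrite (ltnNge m a) (ltnW am) /= bm /= (negbTE bs) orbF des_cons2 des_cons2 bm.
rewrite (ltnNge m a) (ltnW am) /= add0n des_cons2.
(* The slot between [a] and [b] is split off: it is blocked exactly when [b] starts a descent. The
   other slots lie behind [b], where the pair [a], [b] only contributes its own descent. *)
transitivity ((if ~~ (head b s < b)%N then 'X^(1 + des (b :: s)) else 0) +
   'X^(b < a)%N * \sum_(j < (size s).+1 | ~~ has_ddes (b :: ins m j s))
      'X^(des (b :: ins m j s)) : {poly R}).
  congr (_ + _); rewrite mulr_sumr [RHS]big_mkcond /=; apply: eq_bigr => j _.
  rewrite /bump /= add1n insS has_ddes_cons2 des_cons2 negb_or exprD.
  (* No double descent arises at [a]: directly behind [b] now stands either the larger [m] or the
     same letter as before. *)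
  suff -> : ~~ ((b < a) && (head b (ins m j s) < b))%N by [].
  move: ab; case: j => -[|j] jlt /=; first by rewrite ins0 /= (ltnNge m b) (ltnW bm) andbF.
  by case: s jlt {IH bs sm} => //= c s jlt.
rewrite IH; move: ab; set k := des _; set e := (head b s < b)%N.
move: (size s) => l.
case: (b < a)%N; case: e => //= _; rewrite -!mul_polyC ?exprS ?add0n ?add1n -?muln2;
  rewrite ?expr0 ?mul1r ?[(l.+1)%:R]mulrS ?[(k.+2)%:R]mulrS ?[(k.+1)%:R]mulrS ?natrM;
  rewrite ?[(k.+1)%:R]mulrS !(rmorphD, rmorphB, rmorphM, rmorphN) /= ?polyC1 ?polyC0 ?mulr0n;
  ring.
Qed.

(** The front slot is open exactly when there is no initial descent, that is, when the correction
    term of [tail_sumE] vanishes; so the total does not depend on the first step. *)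
Lemma ins_sumE m s : ~~ has_ddes s -> all (ltn^~ m) s ->
  ins_sum m xpredT s = (des s).+1%:R *: 'X^(des s) +
   ((size s)%:R - (des s).*2%:R) *: 'X^((des s).+1).
Proof.
rewrite /ins_sum; case: s => [_ _|a s ds am].
  by rewrite big_mkcond big_ord1 ins0 has_ddes1 /= des1 des0 subrr scale0r addr0 scale1r.
transitivity ((if ~~ (head a s < a)%N then 'X^((des (a :: s)).+1) else 0) + tail_sum m a s).
  rewrite big_mkcond big_ord_recl; congr (_ + _).
    rewrite ins0 has_ddes_cons2 des_cons2 (negbTE ds) /= orbF andbT.
    by case/andP: am => /= -> _.
  rewrite /tail_sum [RHS]big_mkcond; apply: eq_bigr => j _.
  by rewrite !lift0 insS andbT.
rewrite tail_sumE //= -!mul_polyC -?muln2.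
move: (des _) (size s) => k l.
case: (head a s < a)%N => /=; rewrite exprS ?[(l.+1)%:R]mulrS natrM ?[(k.+1)%:R]mulrS;
  rewrite !(rmorphD, rmorphB, rmorphM, rmorphN) /= ?polyC1 ?polyC0; ring.
Qed.

(** On a one-letter word the missing letter reads 0 and [minus] is false, which gives the base case
    of [Pminus_Spoly]. *)
Definition minus s := (nth 0 s 0 < nth 0 s 1)%N.

(** After an initial descent [a > b], only the slot between them yields an initial ascent, trading
    that descent for [m > b]. After an initial ascent, every open slot except the front one keeps
    it, and [tail_sumE] applies. *)
Lemma ins_sum_minusE m s : (0 < size s)%N -> uniq s -> ~~ has_ddes s -> all (ltn^~ m) s ->
  ins_sum m minus s = 'X^(des s) + (if minus s then
   (des s)%:R *: 'X^(des s) +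
   ((size s).-1%:R - (des s).*2%:R) *: 'X^((des s).+1) else 0).
Proof.
rewrite /ins_sum; case: s => [|a s] // _ sU ds am.
transitivity (\sum_(j < (size s).+1 | ~~ has_ddes (a :: ins m j s) && minus (a :: ins m j s))
    'X^(des (a :: ins m j s)) : {poly R}).
  have /andP[/= am' _] := am.
  have m0 : minus (ins m 0 (a :: s)) = false by rewrite ins0 /minus /= ltnNge (ltnW am').
  rewrite big_mkcond big_ord_recl m0 andbF [RHS]big_mkcond [LHS]add0r.
  by apply: eq_bigr => j _; rewrite !lift0 insS.
case: s sU ds am => [|b s] sU ds am.
  rewrite big_mkcond big_ord1 /= ins0 /minus /= andbT in am *.
  by rewrite am has_ddes_cons2 ltnn andbF has_ddes1 /= des_cons2 !des1 ltnNge (ltnW am) /= addr0.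
rewrite {2}/minus /=; case: ltnP => ab.
  have -> : \sum_(j < (size (b :: s)).+1 | ~~ has_ddes (a :: ins m j (b :: s)) &&
      minus (a :: ins m j (b :: s))) 'X^(des (a :: ins m j (b :: s))) = tail_sum m a (b :: s).
    apply: eq_bigl => -[[|j] jlt] /=; rewrite ?ins0 ?insS /minus /= ?ab ?andbT //.
    by case/andP: am => /= ->; rewrite andbT.
  rewrite tail_sumE //= ltnNge (ltnW ab) /= addr0.
  by rewrite addrA [(des _).+1%:R]mulrSr scalerDl scale1r [_ + 'X^_]addrC.
have {}ab : (b < a)%N.
  by rewrite ltn_neqAle ab andbT; case/andP: sU; rewrite inE negb_or eq_sym => /andP[].
rewrite addr0 big_mkcond big_ord_recl big1 => [|j _].
  move: ds; rewrite ins0 /minus /= !has_ddes_cons2 !des_cons2 ab /= negb_or => /andP[hb bs].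
  case/and3P: am => /= am bm _; rewrite am bm (negbTE hb) (negbTE bs).
  by rewrite (ltnNge m a) (ltnW am) /= addr0.
by rewrite !lift0 insS /minus /= (ltnNge a b) (ltnW ab) andbF.
Qed.

Lemma derivXs k : 'X * ('X^k)^`() = k%:R *: 'X^k :> {poly R}.
Proof.
rewrite derivXn scaler_nat mulrnAr; case: k => [|k]; first by rewrite !mulr0n.
by rewrite -exprS.
Qed.

(** Since X d/dX weights a monomial by its exponent, slot counts turn into a differential operator,
    both for all words and for the [minus] ones. *)
Lemma sum_insert_op (r : seq (seq nat)) (P : pred (seq nat)) (c : R) :
  \sum_(s <- r | P s) ((des s)%:R *: 'X^(des s) + (c - (des s).*2%:R) *: 'X^((des s).+1)) =
  c *: 'X * (\sum_(s <- r | P s) 'X^(des s)) +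
  'X * (1 - 2%:R *: 'X) * (\sum_(s <- r | P s) 'X^(des s))^`() :> {poly R}.
Proof.
rewrite raddf_sum !mulr_sumr -big_split /=; apply: eq_bigr => s _.
rewrite mulrAC derivXs exprS -!mul_polyC -muln2 natrM rmorphB rmorphM /=; ring.
Qed.
End Insertion.

(** * Recurrence for S_n and the peak polynomials in terms of S_n and its derivative *)

Section Recurrences.
Variable R : realType.
Local Notation S := (Spoly R).

Lemma Spoly0 : S 0 = 1.
Proof.
rewrite /Spoly (_ : RS 0 = [:: [::]]) ?big_seq1 ?des0 //.
rewrite /RS /= ; case: ifP => // /negP[]; by apply/forallP => -[].
Qed.

Lemma SpolyS n : S n.+1 = (1 + n%:R *: 'X) * S n + 'X * (1 - 2%:R *: 'X) * (S n)^`().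
Proof.
rewrite /Spoly sum_RSS mulrDl -addrA -sum_insert_op mul1r -big_split /=.
rewrite !big_seq; apply: eq_bigr => s sR.
have := @ins_sumE R n.+1 s (RS_ddes sR) (RS_lt sR).
rewrite /ins_sum (RS_size sR) => ->.
by rewrite addrA -natr1 scalerDl scale1r [_ + 'X^_]addrC.
Qed.

Lemma nth_neq n s i j : s \in RS n -> (i < n)%N -> (j < n)%N -> i != j ->
  nth 0%N s i != nth 0%N s j.
Proof. by move=> sR ilt jlt ij; rewrite nth_uniq ?(RS_size sR) ?(RS_uniq sR). Qed.

(* No double descents: every descent but one at the first position is the fall of a peak. *)
Lemma pkE n s : s \in RS n -> (2 <= n)%N ->
  (pk s + (nth 0 s 1 < nth 0 s 0) = des s)%N.
Proof.
move=> sR n2; rewrite /des -(big_mkord xpredT (fun i => (nth 0 s i.+1 < nth 0 s i : nat)%N)).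
rewrite /pk (RS_size sR); case: n n2 sR => [|[|n]] // _ sR.
rewrite [RHS]big_ltn // addnC; congr (_ + _)%N.
rewrite !big_nat; apply: eq_bigr => -[//|i] /andP[_ ilt] /=.
case: (ltnP (nth 0%N s i.+2) (nth 0%N s i.+1)) => h; last by rewrite andbF.
rewrite andbT; case: ltnP => // h1; case/negP: (RS_ddes sR).
apply/existsP.
have ilt' : (i < (size s).-2)%N by rewrite (RS_size sR).
exists (Ordinal ilt') => /=; rewrite h andbT ltn_neqAle h1 andbT.
by rewrite (nth_neq sR) //; lia.
Qed.

Lemma PminusE n : (2 <= n)%N -> Pminus R n = \sum_(s <- RS n | minus s) 'X^(des s).
Proof.
move=> n2; rewrite /Pminus /RSminus big_filter [LHS]big_seq_cond [RHS]big_seq_cond.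
apply: eq_bigr => s /andP[sR]; rewrite -(pkE sR n2) /minus => h.
by rewrite ltnNge (ltnW h) /= addn0.
Qed.

Lemma Spoly_split n : (2 <= n)%N -> S n = Pminus R n + 'X * Pplus R n.
Proof.
move=> n2; rewrite PminusE // /Pplus /RSplus big_filter /Spoly (bigID minus) /=.
congr (_ + _); rewrite mulr_sumr [LHS]big_seq_cond [RHS]big_seq_cond.
apply: eq_big => [s|s /andP[sR]].
  case: (boolP (s \in RS n)) => //= sR; rewrite /minus -leqNgt leq_eqVlt.
  by rewrite (negbTE (nth_neq sR _ _ _)) // (leq_trans _ n2).
rewrite /minus -leqNgt leq_eqVlt (negbTE (nth_neq sR _ _ _)) ?(leq_trans _ n2) //= => h.
by rewrite -(pkE sR n2) h addn1 exprS.
Qed.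

Lemma Ppoly_split n : (2 <= n)%N -> Ppoly R n = Pminus R n + Pplus R n.
Proof.
move=> n2; rewrite /Pminus /Pplus /RSplus /RSminus !big_filter /Ppoly (bigID minus) /=.
congr (_ + _); rewrite [LHS]big_seq_cond [RHS]big_seq_cond; apply: eq_bigl => s.
case: (boolP (s \in RS n)) => //= sR; rewrite /minus -leqNgt leq_eqVlt.
by rewrite (negbTE (nth_neq sR _ _ _)) // (leq_trans _ n2).
Qed.

(** The monomial that [ins_sum_minusE] gives for every word sums to [S n.+1]. The constant is [n],
    not [n.+1], because the front slot is lost. *)
Lemma Pminus_rec n : \sum_(s <- RS n.+2 | minus s) 'X^(des s) =
  S n.+1 + (n%:R *: 'X * (\sum_(s <- RS n.+1 | minus s) 'X^(des s)) +
  'X * (1 - 2%:R *: 'X) * (\sum_(s <- RS n.+1 | minus s) 'X^(des s))^`()) :> {poly R}.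
Proof.
rewrite -sum_insert_op sum_RSS /Spoly [X in _ + X]big_mkcond -big_split /=.
rewrite !big_seq; apply: eq_bigr => s sR.
have sz := RS_size sR.
have := @ins_sum_minusE R n.+2 s _ (RS_uniq sR) (RS_ddes sR) (RS_lt sR).
by rewrite /ins_sum sz => ->.
Qed.

(** By induction through [Pminus_rec]: once the leading S-term is cancelled, the claim is X times
    the derivative of the recurrence [SpolyS]. *)
Lemma Pminus_Spoly n : Pminus R n.+2 = S n.+1 + 'X * (S n.+1)^`().
Proof.
rewrite PminusE //; elim: n => [|n IH].
  rewrite Pminus_rec.
  have -> : \sum_(s <- RS 1 | minus s) 'X^(des s) = 0 :> {poly R}.
    rewrite big_seq_cond big1 // => s /andP[sR].
    have := RS_size sR; case: s sR => [|a [|]] // _ _; by rewrite /minus.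
  by rewrite SpolyS Spoly0 scale0r !derivE; ring.
rewrite Pminus_rec IH; congr (_ + _).
rewrite (SpolyS n.+1) !derivE -!mul_polyC.
by ring.
Qed.

Lemma Pplus_Spoly n : Pplus R n.+2 = n.+1%:R *: S n.+1 - 2%:R *: ('X * (S n.+1)^`()).
Proof.
have e : 'X * Pplus R n.+2 = S n.+2 - Pminus R n.+2.
  by rewrite Spoly_split // addrAC subrr add0r.
apply: (@mulfI _ 'X); first by rewrite polyX_eq0.
by rewrite e Pminus_Spoly SpolyS -!mul_polyC; ring.
Qed.

Lemma Ppoly_Spoly n : Ppoly R n.+2 = n.+2%:R *: S n.+1 - 'X * (S n.+1)^`().
Proof.
rewrite Ppoly_split // Pminus_Spoly Pplus_Spoly [n.+2%:R]mulrS mulr2n.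
by rewrite !scalerDl !scale1r; ring.
Qed.
End Recurrences.

(** * Zeros located by alternating signs *)

Section Roots.
Variable R : realType.
Implicit Types (p q : {poly R}) (xs ys : seq R).

Lemma alternating_signs (a b : R) k :
  0 < (-1) ^+ k.+1 * a -> 0 < (-1) ^+ k * b -> a * b < 0.
Proof.
move=> ha hb; have := mulr_gt0 ha hb.
have s1 : ((-1) ^+ k * (-1) ^+ k = 1 :> R) by rewrite -exprMn mulrNN mulr1 expr1n.
have -> : (-1) ^+ k.+1 * a * ((-1) ^+ k * b) = - ((-1) ^+ k * (-1) ^+ k) * (a * b) :> R.
  by rewrite exprS; ring.
by rewrite s1 mulN1r oppr_gt0.
Qed.

(** Each gap between consecutive nodes holds a zero, and there are as many gaps as the degree of
    [q], so these are all the zeros. The exponent makes [q] positive at the last node. *)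
Lemma alternating_roots q ys : (0 < size ys)%N -> sorted <%R ys -> size q = size ys ->
  (forall i, (i < size ys)%N -> 0 < (-1) ^+ (size ys - i.+1) * q.[ys`_i]) ->
  exists xs, [/\ zeros_of q xs, sorted <%R xs, size xs = (size ys).-1 &
    forall i, (i.+1 < size ys)%N -> ys`_i < xs`_i /\ xs`_i < ys`_i.+1].
Proof.
move=> ys0 /(sortedP 0) ysS sq alt.
(* A sigma type lets the chosen zeros be listed by [mkseq]; 0 is a dummy value beyond the last
   gap. *)
have F i : {x | (i.+1 < size ys)%N -> [/\ ys`_i < x, x < ys`_i.+1 & root q x]}.
  have [ilt|] := boolP (i.+1 < size ys)%N; last by exists 0.
  have neg : q.[ys`_i] * q.[ys`_i.+1] < 0.
    apply: (@alternating_signs _ _ (size ys - i.+2)); last exact: alt.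
    by have := alt i (ltnW ilt); rewrite -subSn.
  have [x] := poly_ivtoo (ltW (ysS i ilt)) neg.
  by rewrite in_itv /= => /andP[? ?] ?; exists x.
pose xs := mkseq (fun i => sval (F i)) (size ys).-1.
have sxs : size xs = (size ys).-1 by rewrite size_mkseq.
have xsP i : (i.+1 < size ys)%N -> [/\ ys`_i < xs`_i, xs`_i < ys`_i.+1 & root q xs`_i].
  move=> ilt; rewrite nth_mkseq ?ltn_predRL //; exact: svalP (F i) ilt.
have lxs : sorted <%R xs.
  apply/(sortedP 0) => i; rewrite sxs ltn_predRL => ilt.
  have [_ h _] := xsP i (ltnW ilt); have [h' _ _] := xsP _ ilt.
  exact: lt_trans h h'.
exists xs; split=> //; last by move=> i /xsP[].
split; first by rewrite -size_poly_gt0 sq.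
split; first exact: (sub_sorted (@ltW _ R)).
apply: all_roots_prod_XsubC.
- by rewrite sq sxs prednK.
- by apply/(all_nthP 0) => i; rewrite sxs ltn_predRL => /xsP[].
- rewrite uniq_rootsE; exact: (sorted_uniq lt_trans ltxx).
Qed.

(** Reflection x -> -x, with the sign of the degree, keeps the leading coefficient and moves the
    question to +oo. *)
Lemma horner_minfty q b : 0 < lead_coef q ->
  exists2 x, x < b & 0 < (-1) ^+ (size q).-1 * q.[x].
Proof.
move=> q0; pose e : R := (-1) ^+ (size q).-1.
pose p := e *: (q \Po - 'X).
have pl : lead_coef p = lead_coef q.
  rewrite lead_coefZ lead_coef_comp ?size_polyN ?size_polyX // lead_coefN lead_coefX.
  by rewrite mulrCA -exprMn mulrNN mulr1 expr1n mulr1.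
have [n hn] : exists n, forall x, x >= n -> lead_coef p <= p.[x].
  by apply: poly_pinfty_gt_lc; rewrite pl.
pose y := Num.max n (1 - b).
exists (- y).
  by rewrite ltrNl lt_max; apply/orP; right; lra.
have := hn y; rewrite le_max lexx /= => /(_ isT).
rewrite pl /p hornerZ horner_comp hornerN hornerX; exact: lt_le_trans.
Qed.

Lemma sign_prod_left x xs : all (fun y => x < y) xs ->
  0 < (-1) ^+ size xs * (\prod_(y <- xs) ('X - y%:P)).[x].
Proof.
elim: xs => [|y xs IH] /=; first by rewrite big_nil hornerC mulr1.
case/andP=> xy /IH h; rewrite big_cons hornerM hornerXsubC exprS mulrACA mulr_gt0 //.
by rewrite mulN1r opprB subr_gt0.
Qed.

(** At a simple zero the derivative is the product of the differences to the other zeros; the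
    negative factors come from the larger zeros. *)
Lemma sign_deriv_prod xs i : sorted <%R xs -> (i < size xs)%N ->
  0 < (-1) ^+ (size xs - i.+1) * (\prod_(x <- xs) ('X - x%:P))^`().[xs`_i].
Proof.
elim: xs i => [//|x xs IH] [|i] xsS ilt.
  rewrite big_cons derivM hornerD !hornerM derivB derivX derivC subr0 !hornerE /=.
  rewrite subrr mul0r addr0 ?mul1r subn1 /=.
  exact: sign_prod_left (order_path_min lt_trans xsS).
rewrite big_cons derivM hornerD !hornerM derivB derivX derivC subr0 !hornerE /= subSS.
have /eqP -> : (\prod_(x <- xs) ('X - x%:P)).[xs`_i] == 0.
  by rewrite -/(root _ _) root_prod_XsubC mem_nth.
rewrite add0r mulrCA mulr_gt0 ?IH ?(path_sorted xsS) // subr_gt0.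
by have /allP := order_path_min lt_trans xsS; apply; rewrite mem_nth.
Qed.

Definition neg_simple q xs :=
  [/\ zeros_of q xs, sorted <%R xs, all (fun x => x < 0) xs & 0 < lead_coef q].

Lemma size_zeros_of q xs : zeros_of q xs -> size q = (size xs).+1.
Proof.
case=> q0 [_ qE]; rewrite qE size_scale ?lead_coef_eq0 // size_prod_XsubC //.
Qed.

Lemma sign_deriv q xs i : neg_simple q xs -> (i < size xs)%N ->
  0 < (-1) ^+ (size xs - i.+1) * q^`().[xs`_i].
Proof.
case=> -[_ [_ qE]] xsS _ q0 ilt; rewrite qE derivZ hornerZ mulrCA.
by rewrite mulr_gt0 // sign_deriv_prod.
Qed.

Lemma root_nth q xs i : zeros_of q xs -> (i < size xs)%N -> q.[xs`_i] = 0.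
Proof.
case=> _ [_ qE] ilt; rewrite qE hornerZ.
have /eqP -> : (\prod_(x <- xs) ('X - x%:P)).[xs`_i] == 0.
  by rewrite -/(root _ _) root_prod_XsubC mem_nth.
by rewrite mulr0.
Qed.

Lemma all_nth_lt xs : (forall i, (i < size xs)%N -> xs`_i < 0) -> all (fun x => x < 0) xs.
Proof. by move=> h; apply/(all_nthP 0). Qed.

(** The nodes are the zeros of [p] and one point far to the left, so each zero of [q] falls just
    left of its partner. *)
Lemma alt_left_below p q xs : neg_simple p xs -> size q = size p -> 0 < lead_coef q ->
  (forall i, (i < size xs)%N -> 0 < (-1) ^+ (size xs - i.+1) * q.[xs`_i]) ->
  alt_left q p /\ RZneg q.
Proof.
move=> [pz xsS xsN p0] sq q0 alt; have sp := size_zeros_of pz.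
have [y yx ysg] := horner_minfty xs`_0 q0.
rewrite sq sp /= in ysg.
have [|||i|zs [zz zsS szs zsP]] := @alternating_roots q (y :: xs) => //.
- rewrite /=; case: (xs) xsS yx => //= a l -> ->//.
- by rewrite sq sp.
- by case: i => [|i] /=; rewrite ?subn1 ?subSS //; apply: alt.
rewrite /= in szs zsP.
split.
  exists zs, xs; rewrite szs; do 3 (split=> //).
  by split=> i ilt; [have [_ /ltW] := zsP i ilt|have [/ltW] := zsP i.+1 ilt].
exists zs; split=> //; apply: all_nth_lt => i; rewrite szs => ilt.
by apply: lt_trans (zsP i ilt).2 _; apply: (allP xsN); rewrite mem_nth.
Qed.

(** The degree is one lower, so the gaps between the zeros of [p] already hold all zeros of [q]. *)
Lemma interlaces_below p q xs : neg_simple p xs -> (0 < size xs)%N -> size q = size xs ->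
  (forall i, (i < size xs)%N -> 0 < (-1) ^+ (size xs - i.+1) * q.[xs`_i]) ->
  interlaces q p /\ RZneg q.
Proof.
move=> [pz xsS xsN p0] xs0 sq alt; have sp := size_zeros_of pz.
have [zs [zz zsS szs zsP]] := alternating_roots xs0 xsS sq alt.
have zxs i : (i < size zs)%N -> (i.+1 < size xs)%N by rewrite szs ltn_predRL.
split.
  exists zs, xs; do 2 (split=> //); rewrite sp sq; split=> // i /zxs ilt.
  by have [/ltW ? /ltW] := zsP i ilt.
exists zs; split=> //; apply: all_nth_lt => i /zxs ilt.
by apply: lt_trans (zsP i ilt).2 _; apply: (allP xsN); rewrite mem_nth.
Qed.

Lemma sorted_rcons0 xs : sorted <%R xs -> all (fun x => x < 0) xs -> sorted <%R (rcons xs 0).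
Proof.
case: xs => //= x xs xsS /andP[x0 xsN]; rewrite rcons_path xsS /=.
by have := mem_last x xs; rewrite inE => /predU1P[->//|/(allP xsN)].
Qed.

(** With the opposite signs the extra node is 0, on the right. Strict sortedness is exported for the
    induction on S_n. *)
Lemma alt_left_above p q xs : neg_simple p xs -> size q = size p -> 0 < q.[0] ->
  (forall i, (i < size xs)%N -> 0 < (-1) ^+ (size xs - i) * q.[xs`_i]) ->
  alt_left p q /\ exists2 zs, zeros_of q zs & sorted <%R zs /\ all (fun x => x < 0) zs.
Proof.
move=> [pz xsS xsN p0] sq q0 alt; have sp := size_zeros_of pz.
have [|||i|zs [zz zsS szs zsP]] := @alternating_roots q (rcons xs 0) => //.
- by rewrite size_rcons.
- exact: sorted_rcons0.
- by rewrite size_rcons sq sp.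
- rewrite size_rcons ltnS subSS nth_rcons leq_eqVlt => /predU1P[->|ilt].
    by rewrite ltnn eqxx subnn mul1r.
  by rewrite ilt alt.
rewrite size_rcons /= in szs zsP.
have {}zsP i : (i < size xs)%N -> xs`_i < zs`_i /\
    (if (i.+1 < size xs)%N then zs`_i < xs`_i.+1 else zs`_i < 0).
  by move=> ilt; have := zsP i ilt; rewrite !nth_rcons ilt if_same; case: ifP.
split.
  exists xs, zs; do 3 (split=> //).
  split=> i ilt; first exact: ltW (zsP i ilt).1.
  by have [_] := zsP i (ltnW ilt); rewrite ilt => /ltW.
exists zs => //; split=> //; apply: all_nth_lt => i; rewrite szs => ilt.
have [_] := zsP i ilt; case: ifP => // h /lt_trans; apply.
by apply: (allP xsN); rewrite mem_nth.
Qed.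

Lemma neg_simple_above p q xs : neg_simple p xs -> size q = (size p).+1 ->
  0 < lead_coef q -> 0 < q.[0] ->
  (forall i, (i < size xs)%N -> 0 < (-1) ^+ (size xs - i) * q.[xs`_i]) ->
  exists zs, neg_simple q zs.
Proof.
move=> [pz xsS xsN p0] sq ql q0 alt; have sp := size_zeros_of pz.
(* The default 0 matters: for empty [xs] the nodes are [y] and 0, and [y] must be negative. *)
have [y yx ysg] := horner_minfty (head 0 xs) ql.
rewrite sq sp /= in ysg.
have [|||i|zs [zz zsS szs zsP]] := @alternating_roots q (y :: rcons xs 0) => //.
- have := sorted_rcons0 xsS xsN; case: (xs) yx => [|a l] //= -> //.
- by rewrite /= size_rcons sq sp.
- rewrite /= size_rcons; case: i => [|i]; first by rewrite subn1.
  rewrite ltnS ltnS subSS subSS /= nth_rcons leq_eqVlt => /predU1P[->|ilt].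
    by rewrite ltnn eqxx subnn mul1r.
  by rewrite ilt alt.
rewrite /= size_rcons in szs zsP.
exists zs; split=> //; apply: all_nth_lt => i; rewrite szs => ilt.
apply: lt_le_trans (zsP i _).2 _; first by rewrite ltnS.
rewrite /= nth_rcons; case: ifP => [h|_]; last by case: ifP.
by apply/ltW/(allP xsN); rewrite mem_nth.
Qed.

Lemma size_lead_coef_gt0 q d : 0 < q`_d -> (forall k, (d < k)%N -> q`_k = 0) ->
  size q = d.+1 /\ 0 < lead_coef q.
Proof.
move=> qd qk; have sq : size q = d.+1.
  apply/eqP; rewrite eqn_leq; apply/andP; split; first by apply/leq_sizeP.
  by rewrite ltnNge; apply/negP => /leq_sizeP/(_ d (leqnn d)) e; rewrite e ltxx in qd.
by rewrite lead_coefE sq.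
Qed.
End Roots.

(** * Zeros of the descent and peak polynomials *)

Section PeakPolynomials.
Variable R : realType.
Local Notation S := (Spoly R).

Lemma coef_Xderiv (p : {poly R}) k : ('X * p^`())`_k = k%:R * p`_k.
Proof.
by rewrite coefXM coef_deriv; case: k => [|k] /=; rewrite ?mul0r // mulr_natl.
Qed.

Lemma coef_SpolyS n k : (S n.+1)`_k = k.+1%:R * (S n)`_k +
  (if k is j.+1 then (n%:R - j.*2%:R) * (S n)`_j else 0).
Proof.
have -> : S n.+1 = S n + 'X * (S n)^`() + 'X * (n%:R *: S n - 2%:R *: ('X * (S n)^`())).
  by rewrite SpolyS -!mul_polyC; ring.
rewrite !coefD coef_Xderiv coefXM; case: k => [|k] /=.
  by rewrite mul0r mul1r addr0.
rewrite coefB !coefZ coef_Xderiv [k.+2%:R]mulrS -muln2 natrM; ring.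
Qed.

(** The term coming from the coefficient of index j carries the factor n - 2j, which vanishes at j =
    n/2 and so caps the degree. *)
Lemma coef_Spoly_eq0 n k : (n < k.*2)%N -> (S n)`_k = 0.
Proof.
elim: n k => [|n IH] [|k] // hk; first by rewrite Spoly0 coef1.
rewrite coef_SpolyS IH; last by lia.
have [->|h] := eqVneq n k.*2; first by rewrite subrr mulr0 mul0r addr0.
by rewrite IH ?mulr0 ?addr0 //; lia.
Qed.

Lemma coef_Spoly_gt0 n k : (k.*2 <= n)%N -> 0 < (S n)`_k.
Proof.
elim: n k => [|n IH] k hk.
  by rewrite (_ : k = 0%N) ?Spoly0 ?coef1 ?ltr01 //; lia.
rewrite coef_SpolyS; have [h|h] := leqP k.*2 n.
  rewrite ltr_wpDr ?mulr_gt0 ?IH ?ltr0n //; case: k hk h => // k _ h.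
  by rewrite mulr_ge0 ?(ltW (IH _ _)) ?subr_ge0 ?ler_nat //; lia.
rewrite coef_Spoly_eq0 // mulr0 add0r; case: k hk h => // k hk h.
by rewrite mulr_gt0 ?IH ?subr_gt0 ?ltr_nat //; lia.
Qed.

Lemma size_Spoly n : size (S n) = n./2.+1.
Proof.
apply: (proj1 (@size_lead_coef_gt0 _ _ n./2 _ _)); first by apply: coef_Spoly_gt0; lia.
by move=> k hk; apply: coef_Spoly_eq0; lia.
Qed.

Lemma lead_coef_Spoly_gt0 n : 0 < lead_coef (S n).
Proof. by rewrite lead_coefE size_Spoly coef_Spoly_gt0 //=; lia. Qed.

Lemma signN_Xderiv n xs i : neg_simple (S n) xs -> (i < size xs)%N ->
  0 < (-1) ^+ (size xs - i.+1) * - ('X * (S n)^`()).[xs`_i].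
Proof.
move=> Sxs ilt; have := sign_deriv Sxs ilt; case: Sxs => _ _ /allP xsN _ h.
rewrite hornerM hornerX -mulNr mulrCA mulr_gt0 // oppr_gt0.
by apply: xsN; rewrite mem_nth.
Qed.

Lemma sign_Xderiv n xs i : neg_simple (S n) xs -> (i < size xs)%N ->
  0 < (-1) ^+ (size xs - i) * ('X * (S n)^`()).[xs`_i].
Proof.
move=> Sxs ilt; have := signN_Xderiv Sxs ilt.
by rewrite (_ : size xs - i = (size xs - i.+1).+1)%N ?exprS ?mulN1r ?mulNr -?mulrN //; lia.
Qed.

Lemma Spoly_neg_simple n : exists xs, neg_simple (S n) xs.
Proof.
elim: n => [|n [xs Sxs]].
  exists [::]; split=> //; last exact: lead_coef_Spoly_gt0.
  by rewrite Spoly0; split; rewrite ?oner_eq0 // lead_coef1 big_nil scale1r.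
have [Sz _ xsN _] := Sxs.
have sgn i : (i < size xs)%N -> 0 < (-1) ^+ (size xs - i) * (S n.+1).[xs`_i].
  move=> ilt; rewrite SpolyS -mulrA [_ * (_ * _)]mulrCA.
  rewrite hornerD hornerM (root_nth Sz ilt) mulr0 add0r hornerM mulrCA mulr_gt0 ?sign_Xderiv //.
  have x0 : xs`_i < 0 by apply: (allP xsN); rewrite mem_nth.
  by rewrite !hornerE; lra.
have S0 : 0 < (S n.+1).[0] by rewrite horner_coef0 coef_Spoly_gt0.
(* The degree, n/2 rounded down, rises exactly for odd [n]; the new zero then lies left of all the
   old ones. *)
have [odd_n|even_n] := boolP (odd n).
  apply: (neg_simple_above Sxs) => //; last exact: lead_coef_Spoly_gt0.
  by rewrite !size_Spoly; lia.
have ss : size (S n.+1) = size (S n) by rewrite !size_Spoly; lia.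
have [_ [zs zz [zsS zsN]]] := alt_left_above Sxs ss S0 sgn.
by exists zs; split=> //; exact: lead_coef_Spoly_gt0.
Qed.

Lemma Ppoly_alt_left n : alt_left (Ppoly R n.+2) (S n.+1) /\ RZneg (Ppoly R n.+2).
Proof.
have [xs Sxs] := Spoly_neg_simple n.+1; have [Sz _ _ _] := Sxs.
have [sP lP] : size (Ppoly R n.+2) = n.+1./2.+1 /\ 0 < lead_coef (Ppoly R n.+2).
  have cP k : (Ppoly R n.+2)`_k = (n.+2%:R - k%:R) * (S n.+1)`_k.
    by rewrite Ppoly_Spoly coefB coefZ coef_Xderiv mulrBl.
  apply: size_lead_coef_gt0 => [|k hk]; rewrite cP.
    by rewrite mulr_gt0 ?coef_Spoly_gt0 // ?subr_gt0 ?ltr_nat; lia.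
  by rewrite coef_Spoly_eq0 ?mulr0 //; lia.
apply: (alt_left_below Sxs) => // [|i ilt]; first by rewrite sP size_Spoly.
by rewrite Ppoly_Spoly hornerD hornerN hornerZ (root_nth Sz ilt) mulr0 add0r signN_Xderiv.
Qed.

Lemma Pminus_alt_left n : alt_left (S n.+1) (Pminus R n.+2) /\ RZneg (Pminus R n.+2).
Proof.
have [xs Sxs] := Spoly_neg_simple n.+1; have [Sz _ _ _] := Sxs.
have cP k : (Pminus R n.+2)`_k = k.+1%:R * (S n.+1)`_k.
  by rewrite Pminus_Spoly coefD coef_Xderiv mulrSr mulrDl mul1r addrC.
have [sP lP] : size (Pminus R n.+2) = n.+1./2.+1 /\ 0 < lead_coef (Pminus R n.+2).
  apply: size_lead_coef_gt0 => [|k hk]; rewrite cP.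
    by rewrite mulr_gt0 ?coef_Spoly_gt0 //; lia.
  by rewrite coef_Spoly_eq0 ?mulr0 //; lia.
have [||i ilt|alt [zs zz [_ zsN]]] := @alt_left_above _ _ (Pminus R n.+2) _ Sxs.
- by rewrite sP size_Spoly.
- by rewrite horner_coef0 cP mul1r coef_Spoly_gt0.
- by rewrite Pminus_Spoly hornerD (root_nth Sz ilt) add0r sign_Xderiv.
- by split=> //; exists zs.
Qed.

Lemma Pplus_prec n : prec (Pplus R n.+2) (S n.+1) /\ RZneg (Pplus R n.+2).
Proof.
have [xs Sxs] := Spoly_neg_simple n.+1; have [Sz _ _ _] := Sxs.
have cP k : (Pplus R n.+2)`_k = (n.+1%:R - k.*2%:R) * (S n.+1)`_k.
  by rewrite Pplus_Spoly coefB !coefZ coef_Xderiv mulrBl -muln2 natrM; ring.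
have sgn i : (i < size xs)%N -> 0 < (-1) ^+ (size xs - i.+1) * (Pplus R n.+2).[xs`_i].
  move=> ilt; rewrite Pplus_Spoly hornerD hornerN !hornerZ (root_nth Sz ilt) mulr0 add0r.
  by rewrite -mulrN mulrCA mulr_gt0 ?signN_Xderiv.
(* The multiplier n+1-2k kills the top coefficient of [S n.+1] exactly for odd [n]: the degree drops
   and the relation is interlacing. For even [n] the degrees agree. *)
have [odd_n|even_n] := boolP (odd n).
  have [sP lP] : size (Pplus R n.+2) = n.+1./2.-1.+1 /\ 0 < lead_coef (Pplus R n.+2).
    apply: size_lead_coef_gt0 => [|k hk]; rewrite cP.
      by rewrite mulr_gt0 ?coef_Spoly_gt0 // ?subr_gt0 ?ltr_nat; lia.
    have [e|h] := eqVneq k.*2 n.+1; first by rewrite e subrr mul0r.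
    by rewrite coef_Spoly_eq0 ?mulr0 //; lia.
  have sx := size_zeros_of Sz; rewrite size_Spoly in sx.
  have [||//|? ?] := @interlaces_below _ _ (Pplus R n.+2) _ Sxs; [lia| |by split=> //; left].
  by rewrite sP; lia.
have [sP lP] : size (Pplus R n.+2) = n.+1./2.+1 /\ 0 < lead_coef (Pplus R n.+2).
  apply: size_lead_coef_gt0 => [|k hk]; rewrite cP.
    by rewrite mulr_gt0 ?coef_Spoly_gt0 // ?subr_gt0 ?ltr_nat; lia.
  by rewrite coef_Spoly_eq0 ?mulr0 //; lia.
have [||//|? ?] := @alt_left_below _ _ (Pplus R n.+2) _ Sxs => //.
  by rewrite sP size_Spoly.
by split=> //; right; left.
Qed.
End PeakPolynomials.

Theorem theorem8 (R : realType) (n : nat) : (2 <= n)%N ->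
  RZneg (Ppoly R n) /\ RZneg (Pplus R n) /\ RZneg (Pminus R n) /\
  alt_left (Ppoly R n.+1) (Spoly R n) /\
  prec (Pplus R n.+1) (Spoly R n) /\
  alt_left (Spoly R n) (Pminus R n.+1).
Proof.
case: n => [|[|n]] // _.
(* Instance [n] places the zeros at the given index; instance [n.+1] supplies the comparisons one
   index higher. *)
have [_ ?] := Ppoly_alt_left R n; have [_ ?] := Pplus_prec R n.
have [_ ?] := Pminus_alt_left R n; have [? _] := Ppoly_alt_left R n.+1.
by have [? _] := Pplus_prec R n.+1; have [? _] := Pminus_alt_left R n.+1.
Qed.
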